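(* Let $C$ be an $s\times m$ matrix with entries in $\mathbb{Q}_+$ and with non-zero columns $c_1,\ldots,c_m$, and let $\mathcal{F}=\{I_n\}_{n=0}^\infty$ be the filtration associated to the covering polyhedron $\mathcal{Q}(C)$. Let $B$ be a rational matrix with non-negative entries and non-zero columns $\beta_1,\ldots,\beta_k$ such that the Newton polyhedron of $I_1$ satisfies ${\rm NP}(I_1)=\mathcal{Q}(B)$, and for $i=1,\ldots,k$ let $n_i$ be a positive integer such that $n_i\beta_i$ is integral. For each $1\leq j\leq k$, let $\rho_j$ be the optimal value of the following linear program in the variables $y=(y_1,\ldots,y_{s+3})$: $$\begin{array}{ll}\text{maximize} & g_j(y)=y_{s+1}\\ \text{subject to} & \langle(y_1,\ldots,y_s),c_i\rangle-y_{s+1}\geq 0,\quad i=1,\ldots,m,\\ & y_{s+1}\geq y_{s+3},\\ & y_i\geq 0,\quad i=1,\ldots,s,\qquad y_{s+3}\geq 0,\\ & n_jy_{s+2}-\langle(y_1,\ldots,y_s),n_j\beta_j\rangle\geq y_{s+3},\qquad y_{s+2}=1,\end{array}$$ and let $\mathcal{P}_j$ be the polyhedron of feasible points of this program. If $\mathcal{F}$ is strict, then $\rho_{ic}(\mathcal{F})=\max\{\rho_j\}_{j=1}^k$ and, for each $1\leq j\leq k$, $\rho_j$ is attained at a rational vertex of $\mathcal{P}_j$. In particular, $\rho_{ic}(\mathcal{F})$ is rational.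
   Context: $S=K[t_1,\ldots,t_s]$ is a polynomial ring over a field $K$; for $a\in\mathbb{N}^s$, where $\mathbb{N}=\{0,1,\ldots\}$, $t^a=t_1^{a_1}\cdots t_s^{a_s}$. $\mathbb{Q}_+$, $\mathbb{R}_+$ are the non-negative rationals and reals. Vector inequalities are componentwise, $\langle\ ,\,\rangle$ is the standard inner product, and $1$ also denotes $(1,\ldots,1)$. For a matrix $C$ with $s$ rows, entries in $\mathbb{Q}_+$ and non-zero columns, its covering polyhedron is $\mathcal{Q}(C)=\{x\in\mathbb{R}^s\mid x\geq 0;\ xC\geq 1\}$ ($x$ a row vector). The filtration associated to $\mathcal{Q}(C)$ is $I_0=S$ and, for $n\geq 1$, $I_n$ the ideal generated by all monomials $t^a$, $a\in\mathbb{N}^s$, with $a/n\in\mathcal{Q}(C)$. It is strict if $I_{n+1}\subsetneq I_n$ for all $n\geq 0$. The Newton polyhedron of a monomial ideal $I$ minimally generated by $t^{v_1},\ldots,t^{v_q}$ is ${\rm NP}(I)=\mathbb{R}_+^s+{\rm conv}(v_1,\ldots,v_q)$ (a matrix $B$ as in the claim always exists). $\overline{L}$ denotes the integral closure of an ideal $L$. The ic-resurgence of $\mathcal{F}$ is $\rho_{ic}(\mathcal{F})=\sup\{m/r\mid m,r \text{ positive integers},\ I_m\not\subset\overline{I_1^r}\}$. *)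

(* Defs.v *)
From mathcomp Require Import all_boot all_order all_algebra.
From mathcomp Require Import classical_sets boolp reals constructive_ereal ereal.
(* The notations of mpoly clash with those of mathcomp-analysis. *)
From mathcomp Require Import -(notations) mpoly.

Set Implicit Arguments.
Unset Strict Implicit.
Unset Printing Implicit Defensive.

Import Order.TTheory GRing.Theory Num.Theory.

Local Open Scope classical_set_scope.
Local Open Scope ring_scope.

(* Ideals are plain sets; only sets produced by [ideal_gen] (or [setT]) are
   used as ideals below. *)
Section Ideals.
Variable A : comNzRingType.

Definition ideal_gen (G : set A) : set A :=
  [set f | exists (n : nat) (c g : 'I_n -> A),
     (forall i, G (g i)) /\ f = \sum_(i < n) c i * g i].

(* For [r = 0] the only generator is the empty product, so [I^0 = A]. *)
Definition ideal_pow (I : set A) (r : nat) : set A :=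
  ideal_gen [set f | exists g : 'I_r -> A,
                (forall i, I (g i)) /\ f = \prod_(i < r) g i].

(* Solutions of f^n + a_1 f^(n-1) + ... + a_n = 0 with n >= 1 and a_i in L^i;
   here a_i is [a i] with i shifted by one. *)
Definition integral_closure (L : set A) : set A :=
  [set f | exists (n : nat) (a : 'I_n -> A),
     [/\ (0 < n)%N,
         forall i : 'I_n, ideal_pow L i.+1 (a i)
       & f ^+ n + \sum_(i < n) a i * f ^+ (n - i.+1) = 0]].

End Ideals.

Section Polyhedra.
Variable R : realType.

Definition toR p q (C : 'M[rat]_(p, q)) : 'M[R]_(p, q) := map_mx ratr C.

Definition inner d (x : 'rV[R]_d) (c : 'cV[R]_d) : R := (x *m c) 0 0.

Definition covering_polyhedron s m (C : 'M[rat]_(s, m)) : set 'rV[R]_s :=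
  [set x : 'rV[R]_s | (forall i, 0 <= x 0 i) /\ (forall j, 1 <= (x *m toR C) 0 j)].

Definition conv d q (v : 'I_q -> 'rV[R]_d) : set 'rV[R]_d :=
  [set x : 'rV[R]_d | exists l : 'I_q -> R,
     [/\ forall i, 0 <= l i, \sum_(i < q) l i = 1
       & x = \sum_(i < q) l i *: v i]].

(* [x] is a vertex when [{x}] is a face of [P]. *)
Definition is_vertex d (P : set 'rV[R]_d) (x : 'rV[R]_d) : Prop :=
  exists (c : 'cV[R]_d) (b : R),
    P `<=` [set y | inner y c <= b] /\ P `&` [set y | inner y c = b] = [set x].

Definition is_rational d (x : 'rV[R]_d) : Prop :=
  exists z : 'rV[rat]_d, x = toR z.

Definition max_value d (P : set 'rV[R]_d) (g : 'rV[R]_d -> R) : \bar R :=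
  ereal_sup [set (g y)%:E | y in P].

End Polyhedra.

Section MonomialIdeals.
Variables (R : realType) (K : fieldType) (s : nat).

Definition exponent_vec (a : multinom s) : 'rV[R]_s :=
  \row_i (a i)%:R.

Definition monomial_ideal (E : set (multinom s)) : set (mpoly s K) :=
  ideal_gen [set mpolyX K a | a in E].

Definition minimally_generated q (I : set (mpoly s K))
    (v : 'I_q -> multinom s) : Prop :=
  I = monomial_ideal (range v) /\
  forall i, monomial_ideal [set v j | j in [set~ i]] <> I.

(* The minimal monomial generators of a monomial ideal are unique up to
   order, so the existential below ranges over a single family. *)
Definition newton_polyhedron (I : set (mpoly s K)) : set 'rV[R]_s :=
  [set x : 'rV[R]_s | exists (q : nat) (v : 'I_q -> multinom s),
     minimally_generated I v /\
     exists u w : 'rV[R]_s, [/\ forall i, 0 <= u 0 i,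
                     conv (fun i => exponent_vec (v i)) w & x = u + w]].

Definition cov_filtration m (C : 'M[rat]_(s, m)) (n : nat) :
    set (mpoly s K) :=
  if n == 0%N then setT
  else monomial_ideal
         [set a | covering_polyhedron C (n%:R^-1 *: exponent_vec a)].

Definition ic_resurgence (F : nat -> set (mpoly s K)) : \bar R :=
  ereal_sup [set z | exists m r : nat,
    [/\ (0 < m)%N, (0 < r)%N,
        ~ (F m `<=` integral_closure (ideal_pow (F 1%N) r))
      & z = (m%:R / r%:R)%:E]].

End MonomialIdeals.

Definition strict_filtration (T : Type) (F : nat -> set T) : Prop :=
  forall n, F n.+1 `<` F n.

Section LinearProgram.
Variables (R : realType) (s : nat).

(* A point y = (y_1, ..., y_(s+3)) of the program. *)
Definition y_vec (y : 'rV[R]_(s + 3)) : 'rV[R]_s := lsubmx y.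
Definition y_s1 (y : 'rV[R]_(s + 3)) : R := y 0 (rshift s (0 : 'I_3)).
Definition y_s2 (y : 'rV[R]_(s + 3)) : R := y 0 (rshift s (1 : 'I_3)).
Definition y_s3 (y : 'rV[R]_(s + 3)) : R := y 0 (rshift s (2 : 'I_3)).

Definition lp_feasible m (C : 'M[rat]_(s, m)) (b : 'cV[rat]_s) (n : nat) :
    set 'rV[R]_(s + 3) :=
  [set y | (forall i, 0 <= inner (y_vec y) (toR R (col i C)) - y_s1 y) /\
           y_s3 y <= y_s1 y /\
           (forall i, 0 <= y_vec y 0 i) /\
           0 <= y_s3 y /\
           y_s3 y <= n%:R * y_s2 y - inner (y_vec y) (toR R (n%:R *: b)) /\
           y_s2 y = 1].

Definition lp_value m (C : 'M[rat]_(s, m)) (b : 'cV[rat]_s) (n : nat) :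
    \bar R :=
  max_value (lp_feasible C b n) y_s1.

End LinearProgram.

Arguments covering_polyhedron R {s m} C.
Arguments newton_polyhedron R {K s} I.
Arguments cov_filtration R K {s m} C n.
Arguments ic_resurgence R {K s} F.
Arguments lp_feasible R {s m} C b n.
Arguments lp_value R {s m} C b n.

(* Main.v *)
Require Import Defs.
From mathcomp Require Import all_boot all_order all_algebra.
From mathcomp Require Import classical_sets boolp reals constructive_ereal ereal.
From mathcomp Require Import -(notations) mpoly.
From mathcomp Require Import zify ring lra.

Import Order.TTheory GRing.Theory Num.Theory.
Local Open Scope classical_set_scope.
Local Open Scope ring_scope.

(** The slack variable y_(s+3) may be taken to be 0 and y_(s+2) is 1, so rho_j
    is the largest t such that some x >= 0 satisfies <x, c_i> >= t for all i and
    <x, beta_j> <= 1.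

    Ideal-theoretically, t^a lies in the integral closure of I_1^r exactly when
    a/r lies in NP(I_1) = Q(B).  If t^a is integral over I_1^r, comparing the
    coefficients of t^(na) in an equation of degree n gives <a, beta_j> >= r,
    because the order of vanishing with weights beta_j is at least 1 on I_1
    ([weight_integral]).  Conversely a polynomial with all exponents in
    r NP(I_1) is integral over J = I_1^r by the determinant trick
    ([integral_of_finite_module]) applied to the module M spanned by the
    monomials with exponent in q NP(I_1), where q is the number of generators
    of I_1: a point of (r + q) NP(I_1) dominates a combination of generators of
    total weight r + q, so r generators in turn can be split off while the rest
    stays in q NP(I_1) ([in_newton_factor]); hence f M is contained in J M.

    So I_p is not contained in the integral closure of I_1^r iff some a has
    a/p in Q(C) and <a, beta_j> < r for some j ([containmentP]); then
    x = a/r, t = p/r is feasible for the j-th program and p/r <= rho_j.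
    Conversely a rational optimal point, cleared of denominators and scaled by
    N/(N+1) to make <x, beta_j> < 1 strict, yields witnesses whose ratios tend
    to rho_j ([lp_value_le_resurgence]).

    The programs are rational, live in the non-negative orthant and are bounded:
    a feasible x with t very large would remain feasible up to scaling after
    erasing its coordinates in the support of beta_j, and rounding up would give
    a monomial of I_1 orthogonal to beta_j ([lp_bounded]).  Such a program
    attains its maximum at a rational vertex ([optimum_at_rational_vertex]): as
    long as the active constraints do not determine the point, it can be moved,
    without decreasing the objective, until one more constraint is active.
    Strictness ensures that B has a column, i.e. that the maximum of the rho_j
    runs over a non-empty set. *)

Set Implicit Arguments.
Unset Strict Implicit.

(** * Ideals, their powers and the determinant trick *)

Section IdealTheory.
Variable A : comNzRingType.
Implicit Types (I J G P : set A) (x y z c : A).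

Definition is_ideal P :=
  [/\ P 0, forall x y, P x -> P y -> P (x + y) & forall c x, P x -> P (c * x)].

Lemma is_ideal_sum P (T : Type) (r : seq T) (F : T -> A) :
  is_ideal P -> (forall i, P (F i)) -> P (\sum_(i <- r) F i).
Proof. by move=> [P0 PD _] PF; elim/big_ind: _. Qed.

Lemma ideal_gen_is_ideal G : is_ideal (ideal_gen G).
Proof.
split.
- exists 0%N, (fun _ => 0), (fun _ => 0); split; first by case.
  by rewrite big_ord0.
- move=> x y [n [c [g [Gg ->]]]] [p [d [h [Gh ->]]]].
  pose F (u : 'I_n -> A) (v : 'I_p -> A) i :=
    match split i with inl j => u j | inr j => v j end.
  exists (n + p)%N, (F c d), (F g h); split.
    by move=> i; rewrite /F; case: (split i).
  rewrite big_split_ord /=; congr (_ + _); apply: eq_bigr => i _; rewrite /F.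
    by rewrite -[lshift p i]/(unsplit (inl i)) unsplitK.
  by rewrite -[rshift n i]/(unsplit (inr i)) unsplitK.
- move=> c x [n [d [g [Gg ->]]]]; exists n, (fun i => c * d i), g; split=> //.
  by rewrite mulr_sumr; apply: eq_bigr => i _; rewrite mulrA.
Qed.

Lemma sub_ideal_gen G : G `<=` ideal_gen G.
Proof.
move=> x Gx; exists 1%N, (fun _ => 1), (fun _ => x); split=> //.
by rewrite big_ord1 mul1r.
Qed.

Lemma ideal_gen_min G P : is_ideal P -> G `<=` P -> ideal_gen G `<=` P.
Proof.
move=> idP GP x [n [c [g [Gg ->]]]]; apply: (is_ideal_sum _ idP) => i.
by case: idP => _ _; apply; apply: GP.
Qed.

Lemma ideal_pow_is_ideal I r : is_ideal (ideal_pow I r).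
Proof. exact: ideal_gen_is_ideal. Qed.

Lemma ideal_powM I a b x y :
  ideal_pow I a x -> ideal_pow I b y -> ideal_pow I (a + b) (x * y).
Proof.
move=> Ix Iy.
have [P0 PD PM] := ideal_pow_is_ideal I (a + b).
apply: (ideal_gen_min (P := [set x | ideal_pow I (a + b) (x * y)])) Ix.
  split=> [|u v|c u] /=; first by rewrite mul0r.
    by rewrite mulrDl; apply: PD.
  by rewrite -mulrA; apply: PM.
move=> _ [g [Ig ->]] /=.
apply: (ideal_gen_min (P := [set y | ideal_pow I (a + b) (_ * y)])) Iy.
  split=> [|u v|c u] /=; first by rewrite mulr0.
    by rewrite mulrDr; apply: PD.
  by rewrite mulrCA; apply: PM.
move=> _ [h [Ih ->]] /=; apply: sub_ideal_gen.
exists (fun i => match split i with inl j => g j | inr j => h j end); split.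
  by move=> i; case: (split i).
rewrite big_split_ord /=; congr (_ * _); apply: eq_bigr => i _.
  by rewrite -[lshift b i]/(unsplit (inl i)) unsplitK.
by rewrite -[rshift a i]/(unsplit (inr i)) unsplitK.
Qed.

Lemma ideal_pow0 I x : ideal_pow I 0 x.
Proof.
have [_ _ PM] := ideal_pow_is_ideal I 0.
rewrite -[x]mulr1; apply: PM; apply: sub_ideal_gen.
by exists (fun=> 0); split; [case | rewrite big_ord0].
Qed.

Lemma ideal_pow1 I x : I x -> ideal_pow I 1 x.
Proof.
by move=> Ix; apply: sub_ideal_gen; exists (fun=> x); rewrite big_ord1.
Qed.

Lemma ideal_pow_le I a b x : (a <= b)%N -> ideal_pow I b x -> ideal_pow I a x.
Proof.
move=> /subnKC <-; set d := (b - a)%N; apply: ideal_gen_min.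
  exact: ideal_pow_is_ideal.
move=> _ [g [Ig ->]]; rewrite big_split_ord /= mulrC.
have [_ _ PM] := ideal_pow_is_ideal I a.
by apply: PM; apply: sub_ideal_gen; exists (fun i => g (lshift d i)).
Qed.

(** Degree-d elements of A[X] when X has degree one and I^i lies in degree i;
    the entries of X - M have degree one if those of M are in I.  Truncated
    subtraction imposes no condition on coefficients beyond d. *)
Definition rees_bounded I d : set {poly A} :=
  [set p | forall i, ideal_pow I (d - i) p`_i].

Lemma rees_boundedM I d e p q :
  rees_bounded I d p -> rees_bounded I e q -> rees_bounded I (d + e) (p * q).
Proof.
move=> Ip Iq i; rewrite coefM.
apply: is_ideal_sum => [|j]; first exact: ideal_pow_is_ideal.
have /= := ideal_powM (Ip j) (Iq (i - j)%N); apply: ideal_pow_le.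
by have := ltn_ord j; lia.
Qed.

Lemma rees_bounded_prod I (T : Type) (r : seq T) (F : T -> {poly A}) :
  (forall i, rees_bounded I 1 (F i)) ->
  rees_bounded I (size r) (\prod_(i <- r) F i).
Proof.
move=> IF; elim: r => [|t r IHr]; first by move=> i; apply: ideal_pow0.
by rewrite big_cons /= -add1n; apply: rees_boundedM.
Qed.

(** Each term of the Leibniz formula is a product of l entries of X - M, and
    these are bounded in degree one. *)
Lemma char_poly_rees_bounded I l (M : 'M[A]_l) :
  (forall i j, I (M i j)) -> rees_bounded I l (char_poly M).
Proof.
move=> IM; have [C0 CX] : rees_bounded I 1 'X /\
    (forall i j, rees_bounded I 1 (M i j)%:P).
  split=> [|i j] [|k].
  - by rewrite coefX; case: (ideal_pow_is_ideal I (1 - 0)).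
  - exact: ideal_pow0.
  - by rewrite coefC; apply: ideal_pow1.
  - exact: ideal_pow0.
rewrite /char_poly /determinant => k; rewrite coef_sum.
apply: is_ideal_sum => [|s]; first exact: ideal_pow_is_ideal.
suff IF i : rees_bounded I 1 (char_poly_mx M i (perm.fun_of_perm s i)).
  have := rees_boundedM (d := 0) (fun i => ideal_pow0 _ _)
            (rees_bounded_prod (index_enum 'I_l) IF).
  have -> : size (index_enum 'I_l) = l.
    by rewrite -[RHS]card_ord cardT enumT; apply/perm_size/permPl.
  by rewrite add0n; apply.
move=> j; have [P0 PD PM] := ideal_pow_is_ideal I (1 - j).
rewrite !mxE coefB; apply: PD; last by rewrite -mulN1r; apply/PM/CX.
by rewrite coefMn; case: eqP => _; [exact: C0 | exact: P0].
Qed.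
End IdealTheory.

(** The determinant trick.  The vector of the e's is killed by f - M for a
    matrix M over I, hence by det(f - M), the value at f of the characteristic
    polynomial of M; a non-zero e cancels in a domain. *)
Lemma integral_of_finite_module (A : idomainType) (I : set A) (T : finType)
    (e : T -> A) (f : A) (t0 : T) :
  e t0 != 0 ->
  (forall t, exists w : T -> A,
     (forall u, I (w u)) /\ f * e t = \sum_u w u * e u) ->
  integral_closure I f.
Proof.
move=> et0 /choice [w fe].
have T0 : (0 < #|T|)%N by apply/card_gt0P; exists t0.
pose M := \matrix_(i < #|T|, j < #|T|) w (enum_val i) (enum_val j).
pose v := \col_(i < #|T|) e (enum_val i).
have Mv : (f%:M - M) *m v = 0.
  apply/colP => i; rewrite mulmxBl mul_scalar_mx !mxE.
  have [_ ->] := fe (enum_val i).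
  rewrite (reindex (@enum_val T T)) /=; last exact: onW_bij (enum_val_bij _).
  by apply/eqP; rewrite subr_eq0; apply/eqP/eq_bigr => j _; rewrite !mxE.
have detM : \det (f%:M - M) = (char_poly M).[f].
  rewrite -horner_evalE -det_map_mx; congr (\det _); apply/matrixP => i j.
  by rewrite !mxE /= /horner_eval hornerD hornerN hornerC hornerMn hornerX.
have cM0 : (char_poly M).[f] = 0.
  rewrite -detM; apply/eqP; have := congr1 (mulmx (\adj (f%:M - M))) Mv.
  rewrite mulmxA mul_adj_mx mulmx0 mul_scalar_mx => /colP/(_ (enum_rank t0)).
  by rewrite !mxE enum_rankK => /eqP; rewrite mulf_eq0 (negPf et0) orbF.
have IM i j : I (M i j) by rewrite mxE; case: (fe (enum_val i)).
exists #|T|, (fun i => (char_poly M)`_(#|T| - i.+1)); split=> // [i|].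
  have := char_poly_rees_bounded IM (#|T| - i.+1)%N.
  by rewrite subKn.
rewrite -[RHS]cM0 horner_coef size_char_poly big_ord_recr /=.
have /monicP := char_poly_monic M; rewrite lead_coefE size_char_poly /= => ->.
rewrite mul1r addrC; congr (_ + _); by rewrite [RHS](reindex_inj rev_ord_inj).
Qed.

(** * Monomial ideals *)
Section MonomialIdealTheory.
Variables (K : fieldType) (s : nat).
Implicit Types (E : set (multinom s)) (f g : mpoly s K) (a b c : multinom s).

Lemma supported_is_ideal E :
  (forall a b, E a -> E (mnm_add a b)) ->
  is_ideal [set f : mpoly s K | forall a, a \in msupp f -> E a].
Proof.
move=> Eup; split=> [a|f g Ef Eg a|f g Eg a] /=.
- by rewrite msupp0.
- by move/msuppD_le; rewrite mem_cat => /orP[/Ef|/Eg].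
- move/msuppM_le/allpairsP => [[b c] /= [_ /Eg Ec ->]].
  by rewrite addmC; apply: Eup.
Qed.

Lemma monomial_idealP E f :
  monomial_ideal E f <-> forall b, b \in msupp f -> exists2 a, E a & lem a b.
Proof.
split.
  apply: (ideal_gen_min (P := [set f | forall b, b \in msupp f ->
      exists2 a, E a & lem a b])).
    apply: supported_is_ideal => b c [a Ea le_ab]; exists a => //.
    by apply: (lepm_trans le_ab); apply: lem_addr.
  move=> _ [a Ea <-] b /mem_msuppXP <-; exists a => //; exact: lepm_refl.
move=> Ef; rewrite (mpolyE f) big_seq.
have [P0 PD PM] := ideal_gen_is_ideal [set mpolyX K a | a in E].
apply: big_ind => [//|//|b /Ef[a Ea le_ab]].
rewrite -mul_mpolyC; apply: (PM); rewrite -(submK le_ab) mpolyXD; apply: PM.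
by apply: sub_ideal_gen; exists a.
Qed.

Lemma monomial_ideal_mpolyX E b :
  monomial_ideal E (mpolyX K b) <-> exists2 a, E a & lem a b.
Proof.
split=> [/monomial_idealP|Eb]; first by apply; rewrite msuppX mem_head.
by apply/monomial_idealP => c /mem_msuppXP <-.
Qed.

End MonomialIdealTheory.

(** * Newton polyhedra and integral closure *)
Section Newton.
Variables (R : realType) (K : fieldType) (s q : nat) (v : 'I_q -> multinom s).
Implicit Types (a b c : multinom s) (f : mpoly s K).

(** Membership in the dilated polyhedron T NP(I), with the sum of the mu k in
    place of a convex combination so that T may be 0. *)
Definition in_newton (T : R) b :=
  exists mu : 'I_q -> R, [/\ forall k, 0 <= mu k, \sum_k mu k = T
    & forall i, \sum_k mu k * (v k i)%:R <= (b i)%:R].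

Lemma in_newtonD T U a b :
  in_newton T a -> in_newton U b -> in_newton (T + U) (mnm_add a b).
Proof.
move=> [m [m0 <- ma]] [p [p0 <- pb]]; exists (fun k => m k + p k); split.
- by move=> k; rewrite addr_ge0.
- by rewrite big_split.
- move=> i; rewrite mnmDE natrD.
  under eq_bigr do rewrite mulrDl.
  by rewrite big_split lerD.
Qed.

(** At most q weights sum to 1 + T > q, so one of them is at least 1 and a full
    copy of the corresponding generator can be removed. *)
Lemma in_newton_peel (T : R) b : q%:R <= T -> in_newton (1 + T) b ->
  exists k b', b = mnm_add (v k) b' /\ in_newton T b'.
Proof.
move=> qT [mu [mu0 sum_mu mub]].
have [k mu1] : exists k, 1 <= mu k.
  apply: contrapT => /forallNP mu1.
  have : \sum_k mu k <= \sum_(k < q) 1.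
    by apply: ler_sum => k _; have /negP := mu1 k; rewrite -ltNge => /ltW.
  rewrite sum_mu sumr_const card_ord => /(le_trans (lerD (lexx 1) qT)).
  by rewrite gerDr ler10.
have mu'0 j : 0 <= mu j - (j == k)%:R.
  by case: eqP => [->|_]; rewrite ?subr_ge0 // subr0.
have mu'b i : \sum_j (mu j - (j == k)%:R) * (v j i)%:R =
              \sum_j mu j * (v j i)%:R - (v k i)%:R.
  under eq_bigr do rewrite mulrBl.
  rewrite sumrB; congr (_ - _); rewrite (bigD1 k) //= eqxx mul1r big1 ?addr0 //.
  by move=> j /negPf ->; rewrite mul0r.
have le_vb : lem (v k) b.
  apply/mnm_lepP => i; rewrite -(ler_nat R); apply: le_trans (mub i).
  rewrite -subr_ge0 -mu'b; apply: sumr_ge0 => j _; exact: mulr_ge0.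
exists k, (mnm_sub b (v k)); split; first by rewrite addmC submK.
exists (fun j => mu j - (j == k)%:R); split=> // [|i].
  rewrite sumrB sum_mu (bigD1 k) //= eqxx big1; last by move=> j /negPf ->.
  by rewrite addr0 addrAC subrr add0r.
by rewrite mu'b mnmBE natrB ?lerD2r //; move/mnm_lepP: le_vb.
Qed.

Let I : set (mpoly s K) := monomial_ideal (range v).

Lemma in_newton_factor r (T : R) b : q%:R <= T -> in_newton (r%:R + T) b ->
  exists p b', [/\ ideal_pow I r p, mpolyX K b = p * mpolyX K b' & in_newton T b'].
Proof.
move=> qT; elim: r b => [|r IHr] b.
  rewrite add0r => Tb; exists 1, b; rewrite mul1r; split=> //; exact: ideal_pow0.
rewrite -[r.+1]add1n natrD -addrA => /in_newton_peel[|k [b' [-> /IHr]]].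
  by rewrite (le_trans qT) // lerDr.
move=> [p [c [Ip b'E Tc]]]; exists (mpolyX K (v k) * p), c; split=> //.
  apply: ideal_powM => //; apply: ideal_pow1; apply: sub_ideal_gen.
  by exists (v k) => //; exists k.
by rewrite mpolyXD b'E mulrA.
Qed.

(** Capping an exponent at D keeps it in q NP(I), since no weight exceeds q; so
    finitely many monomials generate the module of q NP(I). *)
Let D : multinom s := mnm_muln (\big[@mnm_add s/mnm0]_k v k) q.

Lemma in_newton_bounded b : in_newton q%:R b -> 
  exists c, [/\ in_newton q%:R c, lem c b & lem c D].
Proof.
move=> [mu [mu0 sum_mu mub]].
exists (Multinom [tuple minn (b i) (D i) | i < s]).
split; last 2 first.
- by apply/mnm_lepP => i; rewrite mnmE geq_minl.
- by apply/mnm_lepP => i; rewrite mnmE geq_minr.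
exists mu; split=> // i; rewrite mnmE /minn; case: ifP => // _.
rewrite mulmnE mnm_sumE mulnC natrM natr_sum mulr_sumr; apply: ler_sum => k _.
apply: ler_wpM2r => //; rewrite -sum_mu (bigD1 k) //= lerDl.
by apply: sumr_ge0 => j _.
Qed.

(** The module used in the determinant trick is spanned by the monomials of
    q NP(I); the product of the monomials of f with it lies in (r + q) NP(I). *)
Lemma integral_closure_of_newton r f :
  (forall b, b \in msupp f -> in_newton r%:R b) ->
  integral_closure (ideal_pow I r) f.
Proof.
move=> Nf.
(* The sum of all generators has weight one on each of them. *)
have Nb0 : in_newton q%:R (\big[@mnm_add s/mnm0]_k v k).
  exists (fun=> 1); split=> // [|i]; first by rewrite sumr_const card_ord.
  by rewrite mnm_sumE natr_sum; apply: ler_sum => k _; rewrite mul1r.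
pose T := {c : bmultinom s (mdeg D).+1 | `[< in_newton q%:R (bmnm c) >]}.
pose e (t : T) : mpoly s K := mpolyX K (bmnm (val t)).
have toT b : in_newton q%:R b -> exists (t : T) b', b = mnm_add b' (bmnm (val t)).
  move/in_newton_bounded => [c [Nc cb cD]].
  have dc : (mdeg c < (mdeg D).+1)%N.
    by rewrite ltnS !mdegE leq_sum // => i _; exact/mnm_lepP.
  have Nc' : `[< in_newton q%:R (bmnm (BMultinom dc)) >] by apply/asboolP.
  pose inN (c : bmultinom s (mdeg D).+1) := `[< in_newton q%:R (bmnm c) >].
  by exists (exist inN _ Nc'), (mnm_sub b c); rewrite /= submK.
have [t0 _] := toT _ Nb0.
apply: (@integral_of_finite_module _ _ T e f t0) => [|t].
  by rewrite -msupp_eq0 msuppX.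
have [J0 JD JM] := ideal_pow_is_ideal I r.
pose P := [set g : mpoly s K | exists w : T -> mpoly s K,
     (forall u, ideal_pow I r (w u)) /\ g = \sum_u w u * e u].
suff : P (f * e t) by [].
rewrite (mpolyE f) mulr_suml big_seq; apply: big_ind => [|g h|b /Nf Nb].
- by exists (fun=> 0); split=> //; rewrite big1 // => u _; rewrite mul0r.
- move=> [w [Jw ->]] [x [Jx ->]]; exists (fun u => w u + x u); split.
    by move=> u; apply: JD.
  by rewrite -big_split; apply: eq_bigr => u _; rewrite mulrDl.
- have Nt : in_newton q%:R (bmnm (val t)) by apply/asboolP; exact: (valP t).
  have [p [b' [Jp bE Nb']]] := in_newton_factor (lexx _) (in_newtonD Nb Nt).
  have [u [b'' b'E]] := toT _ Nb'.
  exists (fun u' => (u' == u)%:R * (mcoeff b f *: mpolyX K b'') * p); split.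
    by move=> u'; apply: JM.
  rewrite (bigD1 u) //= eqxx big1 ?addr0; last by move=> i /negPf ->; rewrite !mul0r.
  rewrite mul1r -scalerAl -mpolyXD bE b'E mpolyXD -!scalerAl; congr (_ *: _).
  by rewrite mulrA [p * _]mulrC.
Qed.

End Newton.

(** * Weighted orders of vanishing *)

Section Valuation.
Variables (R : realType) (K : fieldType) (s : nat) (beta : 'I_s -> R).
Hypothesis beta0 : forall i, 0 <= beta i.
Implicit Types (a b : multinom s) (I : set (mpoly s K)).

Definition weight a : R := \sum_i (a i)%:R * beta i.

Lemma weight_ge0 a : 0 <= weight a.
Proof. by apply: sumr_ge0 => i _; rewrite mulr_ge0. Qed.

Lemma weightD a b : weight (mnm_add a b) = weight a + weight b.
Proof.
by rewrite -big_split; apply: eq_bigr => i _; rewrite mnmDE natrD mulrDl.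
Qed.

Lemma weightMn a n : weight (mnm_muln a n) = n%:R * weight a.
Proof.
by rewrite mulr_sumr; apply: eq_bigr => i _; rewrite mulmnE mulnC natrM mulrA.
Qed.

Definition order_ge (c : R) : set (mpoly s K) :=
  [set f | forall b, b \in msupp f -> c <= weight b].

Lemma order_ge_is_ideal c : is_ideal (order_ge c).
Proof.
by apply: supported_is_ideal => a b ca; rewrite weightD ler_wpDr ?weight_ge0.
Qed.

Lemma order_geM c d f g :
  order_ge c f -> order_ge d g -> order_ge (c + d) (f * g).
Proof.
move=> cf dg b /msuppM_le/allpairsP[[b1 b2] /= [/cf ? /dg ? ->]].
by rewrite weightD lerD.
Qed.

Lemma order_ge_pow I c r :
  I `<=` order_ge c -> ideal_pow I r `<=` order_ge (r%:R * c).
Proof.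
move=> Ic; apply: ideal_gen_min; first exact: order_ge_is_ideal.
move=> _ [g [Ig ->]]; elim: r g Ig => [|r IHr] g Ig.
  by move=> b _; rewrite mul0r weight_ge0.
have -> : r.+1%:R * c = c + r%:R * c by rewrite mulrS mulrDl mul1r.
rewrite big_ord_recl.
by apply: order_geM; [exact: Ic | exact: IHr].
Qed.

(** The monomial t^(na) occurs in the leading term of an equation of degree n
    for t^a, hence in some a_i t^((n-i)a), so t^(ia) occurs in a_i in I^i. *)
Lemma weight_integral I c a :
  I `<=` order_ge c -> integral_closure I (mpolyX K a) -> c <= weight a.
Proof.
move=> Ic [n [u [n0 Iu]]] /(congr1 (mcoeff (mnm_muln a n))).
rewrite mcoeff0 mcoeffD mpolyXn mcoeffX eqxx raddf_sum /=.
have [->|] := eqVneq (\sum_(i < n) mcoeff (mnm_muln a n)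
                         (u i * mpolyX K a ^+ (n - i.+1))) 0.
  by move/eqP; rewrite addr0 oner_eq0.
move=> sum0 _; apply: contrapT => /negP ca; case/eqP: sum0.
apply: big1 => i _; rewrite mpolyXn.
have -> : mnm_muln a n = mnm_add (mnm_muln a (n - i.+1)) (mnm_muln a i.+1).
  by apply/mnmP => j; rewrite mnmDE !mulmnE -mulnDr subnK.
rewrite mcoeffMX; apply: memN_msupp_eq0; apply/negP.
move/(order_ge_pow Ic (Iu i)); rewrite weightMn ler_pM2l ?ltr0n //.
exact/negP.
Qed.

End Valuation.

(** * Linear optimisation over rational polyhedra *)

Section Inner.
Variables (R : realType) (d : nat).
Implicit Types (x y z : 'rV[R]_d) (c : 'cV[R]_d).

Lemma innerE x c : inner x c = \sum_i x 0 i * c i 0.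
Proof. by rewrite /inner mxE. Qed.

Lemma innerDl x y c : inner (x + y) c = inner x c + inner y c.
Proof. by rewrite /inner mulmxDl mxE. Qed.

Lemma innerZl a x c : inner (a *: x) c = a * inner x c.
Proof. by rewrite /inner -scalemxAl mxE. Qed.

Lemma innerNl x c : inner (- x) c = - inner x c.
Proof. by rewrite /inner mulNmx mxE. Qed.

Lemma innerZr a x c : inner x (a *: c) = a * inner x c.
Proof. by rewrite /inner -scalemxAr mxE. Qed.

Lemma innerNr x c : inner x (- c) = - inner x c.
Proof. by rewrite /inner mulmxN mxE. Qed.

Lemma inner_col x N (A : 'M[R]_(d, N)) j : inner x (col j A) = (x *m A) 0 j.
Proof. by rewrite innerE mxE; apply: eq_bigr => i _; rewrite !mxE. Qed.

Lemma inner_sumr x (T : Type) (r : seq T) P (F : T -> 'cV[R]_d) :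
  inner x (\sum_(i <- r | P i) F i) = \sum_(i <- r | P i) inner x (F i).
Proof. by rewrite /inner mulmx_sumr summxE. Qed.

End Inner.

Section LinearOptimization.
Variables (R : realType) (d N : nat) (A : 'M[rat]_(d, N)) (b : 'rV[rat]_N).
Implicit Types (x y z : 'rV[R]_d) (S : {set 'I_N}).

Definition polyhedron : set 'rV[R]_d :=
  [set y : 'rV[R]_d | forall j, (y *m toR R A) 0 j <= ratr (b 0 j)].

Definition active y : {set 'I_N} := [set j | (y *m toR R A) 0 j == ratr (b 0 j)].

(** Selecting constraints by zeroing the other columns keeps the dimensions
    fixed, so that all subsets S are handled without casts. *)
Definition masked p S (M : 'M[rat]_(p, N)) : 'M[rat]_(p, N) :=
  \matrix_(i, j) ((j \in S)%:R * M i j).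

Definition basic_solution S : 'rV[rat]_d := masked S b *m pinvmx (masked S A).

Lemma mul_maskedE x S j :
  (x *m toR R (masked S A)) 0 j = (j \in S)%:R * (x *m toR R A) 0 j.
Proof.
rewrite !mxE mulr_sumr; apply: eq_bigr => i _; rewrite !mxE rmorphM /= rmorph_nat.
by rewrite mulrCA.
Qed.

(** When the constraints active at y have full rank, y solves a non-singular
    rational linear system. *)
Lemma active_basic y S : S \subset active y -> row_free (masked S A) ->
  y = toR R (basic_solution S).
Proof.
move=> /fintype.subsetP Sy free.
have freeR : row_free (toR R (masked S A)) by rewrite row_free_map.
rewrite /toR map_mxM map_pinvmx -[LHS](mulmxKp freeR); congr (_ *m _).
apply/rowP => j; rewrite mul_maskedE !mxE rmorphM /= rmorph_nat.
case: (boolP (j \in S)) => [/Sy|_]; last by rewrite !mul0r.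
by rewrite inE mxE => /eqP ->.
Qed.

(** The supporting hyperplane is the sum of the active constraints. *)
Lemma vertex_of_active y : polyhedron y -> row_free (masked (active y) A) ->
  is_vertex polyhedron y.
Proof.
move=> Py free; set S := active y.
exists (\sum_(j in S) col j (toR R A)), (\sum_(j in S) ratr (b 0 j)).
have sumE z : inner z (\sum_(j in S) col j (toR R A)) =
    \sum_(j in S) (z *m toR R A) 0 j.
  by rewrite inner_sumr; apply: eq_bigr => j _; rewrite inner_col.
split=> [z Pz|]; first by rewrite /= sumE; apply: ler_sum.
apply/seteqP; split=> [z [Pz /=]|z /= ->]; last first.
  by split=> //=; rewrite sumE; apply: eq_bigr => j; rewrite inE => /eqP.
rewrite sumE => /eqP; rewrite eq_sym -subr_eq0 -sumrB psumr_eq0; last first.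
  by move=> j _; rewrite subr_ge0.
move=> /allP tight; rewrite /= (active_basic (subxx _) free).
apply: active_basic => //; apply/fintype.subsetP => j jS.
have /implyP/(_ jS) := tight j (mem_index_enum _).
by rewrite inE subr_eq0 eq_sym.
Qed.

Variable c : 'cV[R]_d.
Hypothesis pointed : forall y z, polyhedron y ->
  (forall l, polyhedron (y + l *: z)) -> z = 0.
Hypothesis bounded : exists M, forall y, polyhedron y -> inner y c <= M.

(** A direction z in the kernel of the selected constraints can be replaced by
    -z.  If it changes the objective, orient it upwards: boundedness of the
    objective then stops the ray.  Otherwise the line through y leaves the
    polyhedron on one side, because no line is contained in it. *)
Lemma improving_direction y S : polyhedron y -> ~~ row_free (masked S A) ->
  exists z, [/\ z *m toR R (masked S A) = 0, 0 <= inner z c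
    & exists j, 0 < (z *m toR R A) 0 j].
Proof.
move=> Py; rewrite -(row_free_map (@ratr R)) -kermx_eq0 => /rowV0Pn[z].
move=> /sub_kermxP zS z0.
have [M cM] := bounded.
have blocked u : 0 < inner u c -> exists j, 0 < (u *m toR R A) 0 j.
  move=> uc; apply: contrapT => /forallNP uA.
  have M0 : 0 <= M - inner y c by rewrite subr_ge0 cM.
  have l0 : 0 <= (M - inner y c + 1) / inner u c.
    by apply: divr_ge0; [exact: addr_ge0 | exact: ltW].
  have /cM : polyhedron (y + ((M - inner y c + 1) / inner u c) *: u).
    move=> j; rewrite mulmxDl -scalemxAl mxE [X in _ + X]mxE.
    apply: le_trans (Py j); rewrite gerDl mulr_ge0_le0 //.
    by rewrite leNgt; apply/negP/uA.
  rewrite innerDl innerZl divfK ?gt_eqF //; lra.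
have [zc|zc|zc] := ltrgt0P (inner z c).
- by exists z; split=> //; [exact: ltW|exact: blocked].
- exists (- z); rewrite innerNl mulNmx zS oppr0; split=> //.
    by rewrite oppr_ge0 ltW.
  by apply: blocked; rewrite innerNl oppr_gt0.
have [j zAj] : exists j, (z *m toR R A) 0 j != 0.
  apply: contrapT => /forallNP zA; move/negP: z0; apply; apply/eqP.
  apply: (pointed Py) => l j; rewrite mulmxDl -scalemxAl mxE [X in _ + X]mxE.
  by have /negP := zA j; rewrite negbK => /eqP ->; rewrite mulr0 addr0.
have [zj|] := ltP 0 ((z *m toR R A) 0 j).
  by exists z; split; rewrite ?zc //; exists j.
rewrite le_eqVlt (negPf zAj) /= => zj.
exists (- z); rewrite innerNl mulNmx zS zc !oppr0; split=> //.
by exists j; rewrite mulNmx mxE oppr_gt0.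
Qed.

Lemma more_active y : polyhedron y -> ~~ row_free (masked (active y) A) ->
  exists y', [/\ polyhedron y', inner y c <= inner y' c
    & active y \proper active y'].
Proof.
move=> Py /(improving_direction Py)[z [zS zc [j1 zj1]]].
(* The longest step along z that violates no constraint. *)
pose gap j := (ratr (b 0 j) - (y *m toR R A) 0 j) / (z *m toR R A) 0 j.
have [j0 zj0 minj0] :=
  @arg_minP _ _ _ j1 (fun j => 0 < (z *m toR R A) 0 j) gap zj1.
have gap0 : 0 <= gap j0.
  by apply: divr_ge0; [rewrite subr_ge0; apply: Py | exact: ltW].
have moveE j : ((y + gap j0 *: z) *m toR R A) 0 j =
    (y *m toR R A) 0 j + gap j0 * (z *m toR R A) 0 j.
  by rewrite mulmxDl -scalemxAl mxE [X in _ + X]mxE.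
have zact j : j \in active y -> (z *m toR R A) 0 j = 0.
  move=> jy; have := mul_maskedE z (active y) j.
  by rewrite zS jy mul1r mxE.
exists (y + gap j0 *: z); split.
- move=> j; rewrite moveE; case: (ltP 0 ((z *m toR R A) 0 j)) => zj.
    by rewrite -lerBrDl -ler_pdivlMr // minj0.
  by apply: le_trans (Py j); rewrite gerDl mulr_ge0_le0.
- by rewrite innerDl innerZl lerDl mulr_ge0.
apply/fintype.properP; split.
  apply/fintype.subsetP => j jy; rewrite inE moveE zact // mulr0 addr0.
  by move: jy; rewrite inE.
exists j0; first by rewrite inE moveE /gap divfK ?(gt_eqF zj0) // addrC subrK.
by apply/negP => /zact z0; move: zj0; rewrite z0 ltxx.
Qed.

Lemma reach_basic y : polyhedron y ->
  exists y', [/\ polyhedron y', inner y c <= inner y' c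
    & row_free (masked (active y') A)].
Proof.
have [n] := ubnP (N - #|active y|)%N; elim: n y => // n IHn y le_n Py.
have [free|/(more_active Py)[y1 [Py1 le_y /proper_card lt_y]]] :=
  boolP (row_free (masked (active y) A)); first by exists y.
have leN : (#|active y1| <= N)%N by rewrite -[leqRHS]card_ord max_card.
have [|y' [Py' le_y' free]] := IHn y1 _ Py1.
  by rewrite -ltnS; apply: leq_trans le_n; rewrite ltnS ltn_sub2l // (leq_trans lt_y).
by exists y'; split=> //; apply: le_trans le_y'.
Qed.

(** There are finitely many basic solutions and every point is dominated by one
    of them. *)
Lemma optimum_at_rational_vertex y0 : polyhedron y0 ->
  exists y, [/\ is_vertex polyhedron y, is_rational y, polyhedron y
    & forall y', polyhedron y' -> inner y' c <= inner y c].
Proof.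
move=> /reach_basic[y1 [Py1 _ free1]].
pose sol S : 'rV[R]_d := toR R (basic_solution S).
pose feas S := `[< polyhedron (sol S) /\ row_free (masked (active (sol S)) A) >].
have feasible y : polyhedron y -> row_free (masked (active y) A) ->
    feas (active y) /\ y = sol (active y).
  move=> Py free; have yE := active_basic (subxx _) free.
  by split=> //; apply/asboolP; rewrite /sol -yE.
have [f1 _] := feasible _ Py1 free1.
have [S fS maxS] := @arg_maxP _ _ _ _ feas (fun S => inner (sol S) c) f1.
have [PS freeS] := asboolP _ fS.
exists (sol S); split=> //; first exact: vertex_of_active.
  by exists (basic_solution S).
move=> y /reach_basic[y2 [Py2 le_y free2]]; apply: le_trans le_y _.
by have [f2 ->] := feasible _ Py2 free2; apply: maxS.
Qed.

End LinearOptimization.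

Section RationalPolyhedra.
Variables (R : realType) (d : nat).
Implicit Types P Q : set 'rV[R]_d.

Definition rational_polyhedron P : Prop :=
  exists N (A : 'M[rat]_(d, N)) (b : 'rV[rat]_N), P = polyhedron A b.

Lemma rational_polyhedronI P Q :
  rational_polyhedron P -> rational_polyhedron Q -> rational_polyhedron (P `&` Q).
Proof.
move=> [N [A [b ->]]] [M [E [f ->]]]; exists (N + M)%N, (row_mx A E), (row_mx b f).
rewrite /polyhedron /toR map_row_mx; apply/seteqP; split=> y /=.
  move=> [yA yE] j; rewrite mul_mx_row -[j]splitK /=.
  by case: (split j) => i /=; rewrite ?row_mxEl ?row_mxEr.
rewrite mul_mx_row => yAE; split=> j.
  by have := yAE (lshift M j); rewrite !row_mxEl.
by have := yAE (rshift N j); rewrite !row_mxEr.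
Qed.

Lemma rational_polyhedron_family N (u : 'I_N -> 'cV[rat]_d) (w : 'I_N -> rat) :
  rational_polyhedron
    [set y : 'rV[R]_d | forall j, inner y (toR R (u j)) <= ratr (w j)].
Proof.
exists N, (\matrix_(i, j) u j i 0), (\row_j w j).
have E (y : 'rV[R]_d) j :
    (y *m toR R (\matrix_(i, j) u j i 0)) 0 j = inner y (toR R (u j)).
  by rewrite innerE mxE; apply: eq_bigr => i _; rewrite !mxE.
by apply/seteqP; split=> y Py j; have := Py j; rewrite E mxE.
Qed.

Lemma rational_halfspace (u : 'cV[rat]_d) (w : rat) :
  rational_polyhedron [set y : 'rV[R]_d | inner y (toR R u) <= ratr w].
Proof.
have [N [A [b PE]]] := rational_polyhedron_family (fun _ : 'I_1 => u) (fun=> w).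
by exists N, A, b; rewrite -PE; apply/seteqP; split=> y /= Py //; apply: (Py 0).
Qed.

Lemma lp_optimum_at_rational_vertex P (c : 'cV[R]_d) M y0 :
  rational_polyhedron P -> (forall y i, P y -> 0 <= y 0 i) ->
  (forall y, P y -> inner y c <= M) -> P y0 ->
  exists y, [/\ is_vertex P y, is_rational y, P y
    & forall y', P y' -> inner y' c <= inner y c].
Proof.
move=> [N [A [b ->]]] P0 PM; apply: optimum_at_rational_vertex; last by exists M.
move=> y z Py line; apply/rowP => i; rewrite mxE.
(* This multiple of z brings the i-th coordinate down to -1. *)
apply: contrapT => /eqP zi0; have := P0 _ i (line (- (y 0 i + 1) / z 0 i)).
by rewrite !mxE divfK //; lra.
Qed.

End RationalPolyhedra.

(** * The linear program *)

Section Program.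
Variables (R : realType) (s m : nat) (C : 'M[rat]_(s, m)) (b : 'cV[rat]_s).
Variable n : nat.

Let P : set 'rV[R]_(s + 3) := lp_feasible R C b n.

Definition lp_coef (u : 'cV[rat]_s) (p q r : rat) : 'cV[rat]_(s + 3) :=
  col_mx u (\col_(k < 3) nth 0 [:: p; q; r] k).

Lemma inner_lp_coef (y : 'rV[R]_(s + 3)) u p q r :
  inner y (toR R (lp_coef u p q r)) = inner (y_vec y) (toR R u) +
    (ratr p * y_s1 y + ratr q * y_s2 y + ratr r * y_s3 y).
Proof.
rewrite innerE /toR map_col_mx big_split_ord /= innerE; congr (_ + _).
  by apply: eq_bigr => i _; rewrite col_mxEu [y_vec y _ _]mxE.
rewrite !big_ord_recl big_ord0 addr0 addrA !col_mxEd !mxE /=.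
by congr (_ + _ + _); rewrite mulrC; congr (_ * y _ _); congr rshift; apply: val_inj.
Qed.

Lemma toR0 p q : toR R (0 : 'M_(p, q)) = 0.
Proof. exact: map_mx0. Qed.

Lemma inner_delta d (x : 'rV[R]_d) i : inner x (toR R (delta_mx i 0)) = x 0 i.
Proof.
rewrite innerE (bigD1 i) //= !mxE !eqxx rmorph1 mulr1 big1 ?addr0 // => j ji.
by rewrite !mxE (negPf ji) rmorph0 mulr0.
Qed.

Lemma inner0r d (x : 'rV[R]_d) : inner x (toR R 0) = 0.
Proof. by rewrite toR0 /inner mulmx0 mxE. Qed.

Lemma toRN p q (A : 'M_(p, q)) : toR R (- A) = - toR R A.
Proof. exact: map_mxN. Qed.

Definition lp_simp := (inner_lp_coef, inner0r, toRN, innerNr, inner_delta,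
  rmorphN, @rmorph_nat, rmorph0, rmorph1).

Lemma lp_feasible_rational : rational_polyhedron P.
Proof.
have -> : P =
    [set y | forall i, inner y (toR R (lp_coef (- col i C) 1 0 0)) <= ratr 0] `&`
   ([set y | inner y (toR R (lp_coef 0 (-1) 0 1)) <= ratr 0] `&`
   ([set y | forall i, inner y (toR R (lp_coef (- delta_mx i 0) 0 0 0)) <= ratr 0] `&`
   ([set y | inner y (toR R (lp_coef 0 0 0 (-1))) <= ratr 0] `&`
   ([set y | inner y (toR R (lp_coef (n%:R *: b) 0 (- n%:R) 1)) <= ratr 0] `&`
   ([set y | inner y (toR R (lp_coef 0 0 1 0)) <= ratr 1] `&`
    [set y | inner y (toR R (lp_coef 0 0 (-1) 0)) <= ratr (-1)]))))).
  apply/seteqP; split=> y /=.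
    move=> [y1 [y2 [y3 [y4 [y5 y6]]]]].
    split=> [i|]; first by have := y1 i; rewrite !lp_simp; lra.
    split; first by rewrite !lp_simp; lra.
    split=> [i|]; first by have := y3 i; rewrite !lp_simp; lra.
    split; first by rewrite !lp_simp; lra.
    split; first by rewrite !lp_simp; lra.
    by rewrite !lp_simp; lra.
  move=> [y1 [y2 [y3 [y4 [y5 [y6 y7]]]]]].
  move: y2 y4 y5 y6 y7; rewrite !lp_simp => y2 y4 y5 y6 y7.
  split=> [i|]; first by have := y1 i; rewrite !lp_simp; lra.
  split; first by lra.
  split=> [i|]; first by have := y3 i; rewrite !lp_simp; lra.
  by split; [lra | split; lra].
by do ![apply: rational_polyhedronI]; try exact: rational_halfspace;
  exact: (@rational_polyhedron_family _ _ _ _ (fun=> 0)).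
Qed.

Hypothesis n0 : (0 < n)%N.

Lemma lp_feasible_ge0 y i : P y -> 0 <= y 0 i.
Proof.
move=> [y1 [y2 [y3 [y4 [_ y6]]]]]; rewrite -[i]splitK.
case: (split i) => [j|[[|[|[|]]] // jlt]] /=.
- by have := y3 j; rewrite mxE.
- have -> : Ordinal jlt = 0 by apply: val_inj.
  exact: le_trans y4 y2.
- have -> : Ordinal jlt = 1 by apply: val_inj.
  by rewrite -[y 0 _]/(y_s2 y) y6.
- by have -> : Ordinal jlt = 2 by apply: val_inj.
Qed.

Lemma lp_feasible_proj y : P y ->
  [/\ forall i, 0 <= y_vec y 0 i, 0 <= y_s1 y,
      forall i, y_s1 y <= inner (y_vec y) (toR R (col i C))
    & inner (y_vec y) (toR R b) <= 1].
Proof.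
move=> [y1 [y2 [y3 [y4 [y5 y6]]]]]; split=> // [|i|].
- exact: le_trans y4 y2.
- by rewrite -subr_ge0.
have := le_trans y4 y5; rewrite y6 mulr1 subr_ge0 /toR map_mxZ innerZr rmorph_nat.
by rewrite ger_pMr ?ltr0n.
Qed.

Lemma lp_feasible_lift (x : 'rV[R]_s) t :
  (forall i, 0 <= x 0 i) -> 0 <= t ->
  (forall i, t <= inner x (toR R (col i C))) -> inner x (toR R b) <= 1 ->
  exists2 y, P y & y_s1 y = t.
Proof.
move=> x0 t0 tC xb.
exists (row_mx x (\row_(k < 3) nth 0 [:: t; 1; 0] k)); last first.
  by rewrite /y_s1 row_mxEr mxE.
rewrite /P /lp_feasible /= /y_vec row_mxKl /y_s1 /y_s2 /y_s3 !row_mxEr !mxE /=.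
do !split=> //; first by move=> i; rewrite subr_ge0.
rewrite mulr1 subr_ge0 /toR map_mxZ innerZr rmorph_nat.
by rewrite ger_pMr ?ltr0n.
Qed.

Lemma lp_optimum M : (exists2 y, P y & 0 < y_s1 y) ->
  (forall y, P y -> y_s1 y <= M) ->
  exists y, [/\ is_vertex P y, is_rational y, P y,
    lp_value R C b n = (y_s1 y)%:E & 0 < y_s1 y].
Proof.
move=> [y0 Py0 t0] PM.
have cE y : inner y (toR R (lp_coef 0 1 0 0)) = y_s1 y by rewrite !lp_simp; lra.
have [||y [vy ry Py maxy]] := lp_optimum_at_rational_vertex
  (c := toR R (lp_coef 0 1 0 0)) (M := M) lp_feasible_rational _ _ Py0.
- by move=> y i; apply: lp_feasible_ge0.
- by move=> y /PM; rewrite cE.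
exists y; split=> //; last by have := maxy _ Py0; rewrite !cE; apply: lt_le_trans.
apply/eqP; rewrite eq_le; apply/andP; split.
  by apply: ge_ereal_sup => _ [z Pz <-]; rewrite lee_fin -!cE maxy.
by apply: ereal_sup_ubound; exists y.
Qed.

End Program.

(** * Covering polyhedra and Newton polyhedra *)

Section Covering.
Variables (R : realType) (s : nat).
Implicit Types (a b : multinom s).

Definition ratw (c : 'cV[rat]_s) : 'I_s -> R := fun i => ratr (c i 0).

Lemma ratw_ge0 m (C : 'M[rat]_(s, m)) j :
  (forall i j, 0 <= C i j) -> forall i, 0 <= ratw (col j C) i.
Proof. by move=> C0 i; rewrite /ratw mxE ler0q. Qed.

Lemma inner_toR (x : 'rV[R]_s) c : inner x (toR R c) = \sum_i x 0 i * ratw c i.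
Proof. by rewrite innerE; apply: eq_bigr => i _; rewrite mxE. Qed.

Lemma inner_exponent a c : inner (exponent_vec R a) (toR R c) = weight (ratw c) a.
Proof. by rewrite inner_toR; apply: eq_bigr => i _; rewrite mxE. Qed.

Lemma covering_polyhedronE m (C : 'M[rat]_(s, m)) x :
  covering_polyhedron R C x <->
  (forall i, 0 <= x 0 i) /\ (forall j, 1 <= inner x (toR R (col j C))).
Proof.
suff E j : inner x (toR R (col j C)) = (x *m toR R C) 0 j.
  by split=> -[x0 xC]; split=> // j; have := xC j; rewrite E.
by rewrite /toR map_col inner_col.
Qed.

Lemma covering_exponent m (C : 'M[rat]_(s, m)) n a : (0 < n)%N ->
  covering_polyhedron R C (n%:R^-1 *: exponent_vec R a) <->
  (forall j, n%:R <= weight (ratw (col j C)) a).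
Proof.
move=> n0; have n0R : 0 < n%:R :> R by rewrite ltr0n.
have E j : (1 <= inner (n%:R^-1 *: exponent_vec R a) (toR R (col j C))) =
           (n%:R <= weight (ratw (col j C)) a).
  by rewrite innerZl inner_exponent mulrC ler_pdivlMr // mul1r.
split=> [/covering_polyhedronE[_ aC] j|aC]; first by rewrite -E.
by apply/covering_polyhedronE; split=> [i|j]; rewrite ?E // !mxE mulr_ge0 ?invr_ge0.
Qed.

End Covering.

Section NewtonCovering.
Variables (R : realType) (K : fieldType) (s k : nat) (B : 'M[rat]_(s, k)).
Hypothesis hB0 : forall i j, 0 <= B i j.
Hypothesis hBcol : forall j, col j B != 0.

Lemma covering_nonempty : exists x, covering_polyhedron R B x.
Proof.
pose S j : R := \sum_i ratr (B i j).
have B0 i j : 0 <= ratr (B i j) :> R by rewrite ler0q.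
have S0 j : 0 < S j.
  rewrite lt_neqAle sumr_ge0 ?andbT; last by move=> i _; apply: B0.
  rewrite eq_sym psumr_eq0 //; apply: contra (hBcol j) => /allP S0.
  apply/eqP/colP => i; rewrite !mxE; apply/eqP.
  by have := S0 i (mem_index_enum _); rewrite /= fmorph_eq0.
pose M := \sum_j (S j)^-1.
exists (const_mx M); apply/covering_polyhedronE; split=> [i|j].
  by rewrite mxE; apply: sumr_ge0 => j _; rewrite invr_ge0 ltW.
have -> : inner (const_mx M) (toR R (col j B)) = M * S j.
  by rewrite inner_toR mulr_sumr; apply: eq_bigr => i _; rewrite /ratw !mxE.
apply: (@le_trans _ _ ((S j)^-1 * S j)); first by rewrite mulVf ?lt0r_neq0.
apply: ler_wpM2r; first exact: ltW.
rewrite /M (bigD1 j) //= lerDl.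
by apply: sumr_ge0 => l _; rewrite invr_ge0 ltW.
Qed.

Lemma in_newton_refine q p (v : 'I_q -> multinom s) (w : 'I_p -> multinom s)
    (T : R) b :
  (forall l, exists i, lem (v i) (w l)) -> in_newton w T b -> in_newton v T b.
Proof.
move=> /choice[h vw] [mu [mu0 sum_mu mub]].
exists (fun i => \sum_(l | h l == i) mu l); split=> [i||i].
- exact: sumr_ge0.
- by rewrite -sum_mu [RHS](partition_big h xpredT).
apply: le_trans (mub i); rewrite (partition_big h xpredT) //=; apply: ler_sum => j _.
rewrite mulr_suml; apply: ler_sum => l /eqP <-; apply: ler_wpM2l => //.
by rewrite ler_nat; apply/mnm_lepP/vw.
Qed.

Variable I : set (mpoly s K).
Hypothesis hNP : newton_polyhedron R I = covering_polyhedron R B.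

(** A Newton polyhedron is described here through any minimal generating family;
    all points are brought back to a single one, whose members divide those of
    the others. *)
Lemma newton_generators : exists q (v : 'I_q -> multinom s),
  [/\ I = monomial_ideal (range v),
      forall i j, 1 <= weight (ratw R (col j B)) (v i)
    & forall a r, (0 < r)%N -> (forall j, r%:R <= weight (ratw R (col j B)) a) ->
        in_newton v (r%:R : R) a].
Proof.
have [x] := covering_nonempty; rewrite -hNP => -[q [v [[IE vmin] _]]].
exists q, v; split=> // [i j|a r r0 ar].
  have : newton_polyhedron R I (exponent_vec R (v i)).
    exists q, v; split; first by split.
    exists 0, (exponent_vec R (v i)); rewrite add0r; split=> [l||//].
      by rewrite mxE.
    exists (fun l => (l == i)%:R); split=> [l||]; first by rewrite ler0n.
      by rewrite (bigD1 i) //= eqxx big1 ?addr0 // => l /negPf ->.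
    rewrite (bigD1 i) //= eqxx scale1r big1 ?addr0 // => l /negPf ->.
    by rewrite scale0r.
  by rewrite hNP => /covering_polyhedronE[_ /(_ j)]; rewrite inner_exponent.
have : newton_polyhedron R I (r%:R^-1 *: exponent_vec R a).
  by rewrite hNP; apply/covering_exponent.
move=> [p [w [[IE' _] [u [y [u0 [l [l0 suml ->]] aE]]]]]].
have r0R : 0 < r%:R :> R by rewrite ltr0n.
apply: (@in_newton_refine q p v w) => [i|].
  have : I (mpolyX K (w i)).
    by rewrite IE'; apply: sub_ideal_gen; exists (w i) => //; exists i.
  by rewrite IE => /monomial_ideal_mpolyX[_ [j _ <-]]; exists j.
exists (fun i => r%:R * l i); split=> [i||i].
- by rewrite mulr_ge0.
- by rewrite -mulr_sumr suml mulr1.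
have /(congr1 (fun x : 'rV_s => r%:R * x 0 i)) := aE.
rewrite !mxE mulVKf ?gt_eqF // summxE => ->; rewrite mulrDr mulr_sumr.
apply: ler_wpDl; first by rewrite mulr_ge0.
by apply: ler_sum => j _; rewrite !mxE mulrA.
Qed.

Section Containment.
Variables (m : nat) (C : 'M[rat]_(s, m)).
Hypothesis hC0 : forall i j, 0 <= C i j.
Hypothesis IC : I = cov_filtration R K C 1.

Lemma cov_filtration_mpolyX n a : (0 < n)%N ->
  (forall j, n%:R <= weight (ratw R (col j C)) a) ->
  cov_filtration R K C n (mpolyX K a).
Proof.
move=> n0 aC; rewrite /cov_filtration eqn0Ngt n0; apply: sub_ideal_gen.
by exists a => //; apply/covering_exponent.
Qed.

Lemma cov_filtration_msupp n f a : (0 < n)%N ->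
  cov_filtration R K C n f -> a \in msupp f ->
  forall j, n%:R <= weight (ratw R (col j C)) a.
Proof.
move=> n0; rewrite /cov_filtration eqn0Ngt n0 => /monomial_idealP If /If[b].
move=> /(proj1 (@covering_exponent _ _ _ _ _ _ n0)) bC le_ba j.
rewrite -(submK le_ba) weightD ler_wpDl ?weight_ge0 //.
exact: ratw_ge0.
Qed.

Lemma covering_sub_newton a :
  (forall j, 1 <= weight (ratw R (col j C)) a) ->
  forall j, 1 <= weight (ratw R (col j B)) a.
Proof.
move=> aC j; have [q [v [IE vB _]]] := newton_generators.
have : I (mpolyX K a) by rewrite IC; apply: (@cov_filtration_mpolyX 1).
rewrite IE => /monomial_ideal_mpolyX[_ [i _ <-] le_va].
rewrite -(submK le_va) weightD ler_wpDl ?weight_ge0 //.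
exact: ratw_ge0.
Qed.

Lemma containmentP n r : (0 < n)%N -> (0 < r)%N ->
  cov_filtration R K C n `<=` integral_closure (ideal_pow I r) <->
  forall a, (forall j, n%:R <= weight (ratw R (col j C)) a) ->
            forall j, r%:R <= weight (ratw R (col j B)) a.
Proof.
move=> n0 r0; have [q [v [IE vB vN]]] := newton_generators.
split=> [sub a aC j|sub f If].
  rewrite -[r%:R]mulr1.
  apply: weight_integral (sub _ (cov_filtration_mpolyX n0 aC)).
    by apply: ratw_ge0.
  apply: order_ge_pow; first exact: ratw_ge0.
  rewrite IE; apply: ideal_gen_min; first by apply/order_ge_is_ideal/ratw_ge0.
  by move=> _ [_ [i _ <-] <-] b /mem_msuppXP <-.
rewrite IE; apply: integral_closure_of_newton => b bf.
by apply: vN => // j; apply: sub => // i; apply: cov_filtration_msupp bf i.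
Qed.

(** If t exceeds M, erasing the coordinates of x in the support of beta_j costs
    at most M in each <x, c_l>, since there x_i <= 1/beta_ij.  Dividing by t - M
    and rounding up yields a lattice point of Q(C), hence of Q(B), whose product
    with beta_j is 0. *)
Lemma lp_bounded (j : 'I_k) : exists M : R, forall (x : 'rV[R]_s) t,
  (forall i, 0 <= x 0 i) ->
  (forall i, t <= inner x (toR R (col i C))) ->
  inner x (toR R (col j B)) <= 1 -> t <= M.
Proof.
pose be := ratw R (col j B).
have be0 : forall i, 0 <= be i by apply: ratw_ge0.
pose ce l := ratw R (col l C).
have ce0 l : forall i, 0 <= ce l i by apply: ratw_ge0.
(* Terms with be i = 0 vanish because 0 is its own inverse. *)
pose M : R := \sum_l \sum_i ce l i / be i.
exists M => x t x0 tC xB; rewrite leNgt; apply/negP => Mt.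
have tM0 : 0 < t - M by rewrite subr_gt0.
pose a := Multinom
  [tuple (if be i == 0 then Num.bound (x 0 i / (t - M)) else 0%N) | i < s].
suff /covering_sub_newton/(_ j) : forall l, 1 <= weight (ce l) a.
  rewrite /weight big1 ?ler10 // => i _; rewrite mnmE -/be.
  by case: ifP => [/eqP ->|_]; rewrite ?mulr0 ?mul0r.
move=> l; rewrite -(ler_pM2r tM0) mul1r mulr_suml.
have xbe i : be i != 0 -> x 0 i <= (be i)^-1.
  move=> bei; rewrite -[leRHS]div1r ler_pdivlMr; last by rewrite lt0r bei be0.
  apply: le_trans xB; rewrite inner_toR (bigD1 i) //= lerDl.
  by apply: sumr_ge0 => i' _; rewrite mulr_ge0.
have leM : \sum_i ce l i / be i <= M.
  rewrite /M (bigD1 l) //= lerDl.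
  by do 2![apply: sumr_ge0 => ? _]; rewrite mulr_ge0 ?invr_ge0.
rewrite lerBlDr; apply: le_trans (lerD (lexx _) leM).
apply: le_trans (tC l) _; rewrite inner_toR -big_split; apply: ler_sum => i _ /=.
rewrite mnmE; case: eqVneq => [bei|/xbe xi].
  rewrite bei invr0 mulr0 addr0 mulrAC; apply: ler_wpM2r; first exact: ce0.
  rewrite -ler_pdivrMr // ltW // archi_boundP // divr_ge0 // ltW //.
by rewrite !mul0r add0r mulrC ler_wpM2l // ce0.
Qed.

End Containment.

End NewtonCovering.

Lemma common_denominator (T : finType) (z : T -> rat) : (forall i, 0 <= z i) ->
  exists2 D : nat, (0 < D)%N & exists a : T -> nat, forall i, D%:R * z i = (a i)%:R.
Proof.
move=> z0; exists (\prod_i `|denq (z i)|)%N.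
  by apply: prodn_gt0 => i; rewrite absz_gt0 denq_neq0.
suff /choice[a aE] : forall i, exists a : nat, (\prod_i `|denq (z i)|)%N%:R * z i = a%:R.
  by exists a.
move=> i; exists (\prod_(j | j != i) `|denq (z j)| * `|numq (z i)|)%N.
rewrite (bigD1 i) //= !natrM mulrAC mulrC; congr (_ * _).
rewrite -{2}(divq_num_den (z i)) !pmulrn !abszE !ger0_norm ?denq_ge0 ?numq_ge0 //.
by rewrite mulrC divfK // intq_eq0 denq_neq0.
Qed.

(** * The resurgence *)

Section Resurgence.
Variables (R : realType) (K : fieldType) (s m k : nat).
Variables (C : 'M[rat]_(s, m)) (B : 'M[rat]_(s, k)) (n : 'I_k -> nat).
Hypothesis hC0 : forall i j, 0 <= C i j.
Hypothesis hCcol : forall j, col j C != 0.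
Hypothesis hB0 : forall i j, 0 <= B i j.
Hypothesis hBcol : forall j, col j B != 0.
Hypothesis hNP :
  newton_polyhedron R (cov_filtration R K C 1) = covering_polyhedron R B.
Hypothesis hn0 : forall j, (0 < n j)%N.

Let F := cov_filtration R K C.
Let P j := lp_feasible R C (col j B) (n j).

(** Any point of Q(C), scaled down to satisfy <x, beta_j> <= 1, is feasible. *)
Lemma lp_positive j : exists2 y, P j y & 0 < y_s1 y.
Proof.
have [x /covering_polyhedronE[x0 xC]] := covering_nonempty R hC0 hCcol.
pose e := (1 + inner x (toR R (col j B)))^-1.
have xB0 : 0 <= inner x (toR R (col j B)).
  by rewrite inner_toR; apply: sumr_ge0 => i _; rewrite mulr_ge0 ?ratw_ge0.
have e0 : 0 < e by rewrite invr_gt0 ltr_wpDr.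
have [||i||y Py yE] := @lp_feasible_lift R s m C (col j B) (n j) (hn0 j) (e *: x) e.
- by move=> i; rewrite mxE mulr_ge0 // ltW.
- exact: ltW.
- by rewrite innerZl ler_peMr // ltW.
- by rewrite innerZl mulrC /e ler_pdivrMr ?mul1r ?lerDr // ltr_wpDr.
by exists y; rewrite ?yE.
Qed.

Lemma lp_attained j : exists y, [/\ is_vertex (P j) y, is_rational y, P j y,
  lp_value R C (col j B) (n j) = (y_s1 y)%:E & 0 < y_s1 y].
Proof.
have [M hM] := lp_bounded hB0 hBcol hNP hC0 (erefl _) j.
have PM y : P j y -> y_s1 y <= M.
  by move=> /(lp_feasible_proj (hn0 j))[x0 _ tC xB]; apply: hM x0 tC xB.
exact: (lp_optimum (lp_positive j) PM).
Qed.

Lemma witness_ratio_le p r : (0 < p)%N -> (0 < r)%N ->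
  ~ F p `<=` integral_closure (ideal_pow (F 1%N) r) ->
  exists j, ((p%:R / r%:R)%:E <= lp_value R C (col j B) (n j))%E.
Proof.
move=> p0 r0 nsub; have r0R : 0 < r%:R :> R by rewrite ltr0n.
have [a aC [j aB]] : exists2 a, (forall l, p%:R <= weight (ratw R (col l C)) a) &
    exists j, weight (ratw R (col j B)) a < r%:R.
  apply: contrapT => nex; apply: nsub.
  apply: (proj2 (containmentP hB0 hBcol hNP hC0 p0 r0)) => a aC j.
  by rewrite leNgt; apply/negP => aB; apply: nex; exists a => //; exists j.
exists j; have expE c : inner (r%:R^-1 *: exponent_vec R a) (toR R c) =
    weight (ratw R c) a / r%:R by rewrite innerZl inner_exponent mulrC.
have [||i||y Py yE] := @lp_feasible_lift R s m C (col j B) (n j) (hn0 j)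
    (r%:R^-1 *: exponent_vec R a) (p%:R / r%:R).
- by move=> i; rewrite !mxE mulr_ge0 ?invr_ge0.
- by rewrite divr_ge0.
- by rewrite expE ler_pM2r ?invr_gt0.
- by rewrite expE ler_pdivrMr // mul1r ltW.
by apply: ereal_sup_ubound; exists y; rewrite ?yE.
Qed.

(** The optimum is attained at a rational point, but a witness needs the strict
    inequality <a, beta_j> < r.  With D clearing the denominators, the exponent
    (N+1) D x and r = (N+2) D give the ratio (N+1)/(N+2) rho_j. *)
Lemma lp_value_le_resurgence j :
  (lp_value R C (col j B) (n j) <= ic_resurgence R F)%E.
Proof.
have [y [_ [z yE] Py -> t0]] := lp_attained j.
have [x0 _ tC xB] := lp_feasible_proj (hn0 j) Py.
have z0 i : 0 <= z 0 i.
  by rewrite -(ler0q R); have := lp_feasible_ge0 i Py; rewrite yE mxE.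
have [D D0 [a aE]] := common_denominator z0.
have D0R : 0 < D%:R :> R by rewrite ltr0n.
have yD i : D%:R * y 0 i = (a i)%:R.
  by rewrite yE mxE -(rmorph_nat (@ratr R)) -rmorphM aE rmorph_nat.
pose b := Multinom [tuple a (lshift 3 i) | i < s].
set p := a (rshift s 0); have pE : D%:R * y_s1 y = p%:R by rewrite yD.
have p0 : (0 < p)%N by rewrite -(ltr0n R) -pE mulr_gt0.
have wbE c : weight (ratw R c) b = D%:R * inner (y_vec y) (toR R c).
  rewrite inner_toR mulr_sumr; apply: eq_bigr => i _.
  by rewrite mnmE -yD mulrA mxE.
have ratio N : (((N.+1 * p)%:R / (D * N.+2)%:R)%:E <= ic_resurgence R F)%E.
  apply: ereal_sup_ubound; exists (N.+1 * p)%N, (D * N.+2)%N.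
  have Np0 : (0 < N.+1 * p)%N by rewrite muln_gt0.
  have DN0 : (0 < D * N.+2)%N by rewrite muln_gt0 D0.
  split=> // /(proj1 (containmentP hB0 hBcol hNP hC0 Np0 DN0)).
  move/(_ (mnm_muln b N.+1)) => sub.
  have /sub/(_ j) : forall l,
      (N.+1 * p)%:R <= weight (ratw R (col l C)) (mnm_muln b N.+1).
    move=> l; rewrite weightMn natrM ler_pM2l ?ltr0n // wbE -pE.
    by rewrite ler_pM2l.
  rewrite weightMn wbE natrM mulrCA ler_pM2l // leNgt => /negP; apply.
  apply: (@le_lt_trans _ _ N.+1%:R); last by rewrite ltr_nat.
  by rewrite ler_piMr.
apply/lee_addgt0Pr => e e0; set N := Num.bound (y_s1 y / e).
apply: le_trans (leeD2r _ (ratio N)); rewrite -EFinD lee_fin.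
have -> : (N.+1 * p)%:R / (D * N.+2)%:R = y_s1 y * (N.+1%:R / N.+2%:R).
  rewrite !natrM -pE [RHS]mulrA; apply/eqP.
  rewrite eqr_div ?mulf_neq0 ?pnatr_eq0 -?lt0n //.
  by apply/eqP; ring.
have N0 : 0 < N.+2%:R :> R by rewrite ltr0n.
rewrite -lerBlDl -[X in X - _]mulr1 -mulrBr.
have -> : 1 - N.+1%:R / N.+2%:R = N.+2%:R^-1 :> R.
  by rewrite -[X in X - _](divff (lt0r_neq0 N0)) -mulrBl -natrB // subSnn div1r.
rewrite ler_pdivrMr // mulrC -ler_pdivrMr //.
apply: ltW; apply: lt_trans (archi_boundP _) _; first by rewrite divr_ge0 // ltW.
by rewrite ltr_nat.
Qed.

End Resurgence.

Unset Implicit Arguments.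
Set Strict Implicit.

Theorem theorem5p3 (R : realType) (K : fieldType) (s m k : nat)
    (C : 'M[rat]_(s, m)) (B : 'M[rat]_(s, k)) (n : 'I_k -> nat)
    (hC0 : forall i j, 0 <= C i j)
    (hCcol : forall j, col j C != 0)
    (hB0 : forall i j, 0 <= B i j)
    (hBcol : forall j, col j B != 0)
    (hNP : newton_polyhedron R (cov_filtration R K C 1) =
           covering_polyhedron R B)
    (hn0 : forall j, (0 < n j)%N)
    (hnB : forall i j, (n j)%:R * B i j \is a Num.int)
    (hstrict : strict_filtration (cov_filtration R K C)) :
  [/\ ic_resurgence R (cov_filtration R K C) =
        \big[maxe/-oo%E]_(j < k) lp_value R C (col j B) (n j),
      forall j : 'I_k, exists y : 'rV[R]_(s + 3),
        [/\ is_vertex (lp_feasible R C (col j B) (n j)) y,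
            is_rational y
          & lp_value R C (col j B) (n j) = (y_s1 y)%:E]
    & exists q : rat, ic_resurgence R (cov_filtration R K C) = (ratr q)%:E].
Proof.
have attained := lp_attained hC0 hCcol hB0 hBcol hNP hn0.
have icE : ic_resurgence R (cov_filtration R K C) =
    \big[maxe/-oo%E]_(j < k) lp_value R C (col j B) (n j).
  apply/eqP; rewrite eq_le; apply/andP; split; last first.
    apply: bigmax_le => [|j _]; first exact: leNye.
    exact: lp_value_le_resurgence.
  apply: ge_ereal_sup => _ [p [r [p0 r0 nsub ->]]].
  have [j] := witness_ratio_le hC0 hB0 hBcol hNP hn0 p0 r0 nsub.
  by move/le_trans; apply; exact: le_bigmax.
split=> // [j|].
  by have [y [vy ry _ yE _]] := attained j; exists y.
(* Without columns Q(B) is the whole orthant and 1 is in I_1. *)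
have k0 : (0 < k)%N.
  rewrite lt0n; apply/eqP => k0.
  have [q [v [IE _ vN]]] := newton_generators hB0 hBcol hNP.
  have nob (j : 'I_k) : False by move: (leq_trans (ltn_ord j) (eq_leq k0)).
  have [mu [mu0 sum_mu mub]] := vN mnm0 1%N isT (fun j => False_ind _ (nob j)).
  have [i mui] : exists i, 0 < mu i.
    apply: contrapT => /forallNP mu_le0; move/eqP: sum_mu; apply/negP.
    rewrite lt_eqF // (le_lt_trans _ ltr01) // sumr_le0 // => i _.
    by rewrite leNgt; apply/negP.
  have := proj2 (hstrict 0%N); apply => f _; rewrite IE.
  apply/monomial_idealP => b _; exists (v i); first by exists i.
  apply/mnm_lepP => l; have := mub l; rewrite mnm0E (bigD1 i) //=.
  rewrite leNgt; case: (posnP (v i l)) => [-> //|vil] /negP[].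
  rewrite ltr_pwDl ?mulr_gt0 ?ltr0n // sumr_ge0 // => i' _.
  by rewrite mulr_ge0.
rewrite icE.
have [j _ ->] := @eq_bigmax _ _ _ -oo%E (Ordinal k0) xpredT
  (fun j => lp_value R C (col j B) (n j)) isT (fun j _ => leNye _).
have [y [_ [z yE] _ -> _]] := attained j.
by exists (z 0 (rshift s 0)); rewrite /y_s1 yE mxE.
Qed.
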